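(* Let $(\tilde M,\tilde g)$, $G$, $(M,g)$ and $\mathrm{quo}:\tilde M\to M$ be as described in the context, let $N\ge1$, and let $Q\in M^N$. (a) Let $\tilde p\in\tilde M$ and let $p=\mathrm{quo}(\tilde p)$. Then the following are equivalent: (i) $p\in\mathrm{FM}(Q)$; (ii) $\tilde p\in\mathrm{EFM}(Q)$; (iii) $\mathrm{quo}^{-1}(p)\subset\mathrm{EFM}(Q)$. Thus $\mathrm{EFM}(Q)=\mathrm{quo}^{-1}(\mathrm{FM}(Q))$ and $\mathrm{quo}(\mathrm{EFM}(Q))=\mathrm{FM}(Q)$. (b) $Q$ has a unique Fréchet mean if and only if the equivariant Fréchet mean of $Q$ is unique up to the action of $G$.
   Context: $G$ is a finite group of order at least 2, with identity $e$, acting isometrically (on the left) on a connected smooth Riemannian manifold $(\tilde M,\tilde g)$ with Riemannian distance $\tilde d$, such that $\beta:=\inf\{\tilde d(\tilde p,h\cdot\tilde p):\tilde p\in\tilde M,\ e\ne h\in G\}>0$; in particular the action is free. $M=\tilde M/G$ is the quotient manifold, $\mathrm{quo}:\tilde M\to M$ the quotient map (a covering map), and $g$ the unique Riemannian metric on $M$ making $\mathrm{quo}$ a local isometry; $d$ is its Riemannian distance. For $Q=(q_1,\dots,q_N)\in M^N$, $\mathrm{FM}(Q)\subset M$ is the set of global minimizers (Fréchet means) of $p\mapsto\frac1N\sum_i d(p,q_i)^2$. With $d_{\rm evt}(q,\tilde p)=\min\{\tilde d(\tilde q,\tilde p):\tilde q\in\mathrm{quo}^{-1}(q)\}$ for $q\in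 M$, $\tilde p\in\tilde M$, the set $\mathrm{EFM}(Q)\subset\tilde M$ of equivariant Fréchet means of $Q$ is the set of global minimizers of $\tilde p\mapsto\frac1N\sum_i d_{\rm evt}(q_i,\tilde p)^2$. The equivariant Fréchet mean of $Q$ is unique up to the action of $G$ if $\mathrm{EFM}(Q)$ is nonempty and any two equivariant Fréchet means of $Q$ are related by the action of an element of $G$. *)

(* Defs.v *)
From HB Require Import structures.
From mathcomp Require Import all_boot all_order all_algebra fingroup.
From mathcomp Require Import generic_quotient.
From mathcomp Require Import all_classical all_reals all_analysis.
Set Implicit Arguments.
Unset Strict Implicit.
Unset Printing Implicit Defensive.
Import Order.TTheory GRing.Theory Num.Theory.
Import numFieldNormedType.Exports.
Local Open Scope classical_set_scope.
Local Open Scope ring_scope.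

(* C^k and smooth maps between normed spaces; meant for U open, the source
   being finite dimensional. *)
Fixpoint Ck_on (R : realType) (V W : normedModType R) (k : nat) (U : set V)
    (f : V -> W) : Prop :=
  if k is k'.+1 then
    (forall x, U x -> differentiable f x) /\
    (forall v : V, Ck_on k' U (fun x => 'D_v f x))
  else forall x, U x -> {for x, continuous f}.

Definition smooth_on (R : realType) (V W : normedModType R) (U : set V)
    (f : V -> W) : Prop := forall k, Ck_on k U f.

(* A smooth n-manifold structure on M, given by an indexed smooth atlas.  The
   chart i is the homeomorphism chart_map i from chart_dom i onto its image,
   with inverse chart_inv i; the values of chart_map i outside chart_dom i, and
   of chart_inv i outside that image, are irrelevant. *)
Record smooth_manifold (R : realType) (n : nat) (M : topologicalType) := {
  chart : Type;
  chart_dom : chart -> set M;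
  chart_map : chart -> M -> 'rV[R]_n;
  chart_inv : chart -> 'rV[R]_n -> M;
  chart_at : M -> chart;
  chart_dom_at : forall x, chart_dom (chart_at x) x;
  open_chart_dom : forall i, open (chart_dom i);
  open_chart_codom : forall i, open (chart_map i @` chart_dom i);
  chart_mapK : forall i x, chart_dom i x -> chart_inv i (chart_map i x) = x;
  chart_map_continuous : forall i x, chart_dom i x ->
    {for x, continuous (chart_map i)};
  chart_inv_continuous : forall i x, chart_dom i x ->
    {for chart_map i x, continuous (chart_inv i)};
  transition_smooth : forall i j,
    smooth_on (chart_map i @` (chart_dom i `&` chart_dom j))
      (chart_map j \o chart_inv i);
  manifold_hausdorff : hausdorff_space M;
  manifold_second_countable : @second_countable M
}.

(* gram i x is the Gram matrix of the inner product on the tangent space at x,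
   in the basis given by the chart i (for x in chart_dom i).  The last
   field is the change of coordinates rule of a covariant 2-tensor. *)
Record riemannian_metric (R : realType) (n : nat) (M : topologicalType)
    (S : smooth_manifold R n M) := {
  gram : chart S -> M -> 'M[R]_n;
  gram_smooth : forall i,
    smooth_on (chart_map i @` chart_dom i) (gram i \o chart_inv (s := S) i);
  gram_sym : forall i x, chart_dom i x -> (gram i x)^T = gram i x;
  gram_pos : forall i x, chart_dom i x -> forall v : 'rV[R]_n, v != 0 ->
    0 < (v *m gram i x *m v^T) 0 0;
  gram_compat : forall i j x, chart_dom i x -> chart_dom j x ->
    forall v w : 'rV[R]_n,
    let dtau := 'd (chart_map j \o chart_inv (s := S) i) (chart_map i x) in
    (v *m gram i x *m w^T) 0 0 = (dtau v *m gram j x *m (dtau w)^T) 0 0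
}.

Section Curves.
Context (R : realType) (n : nat) (M : topologicalType).
Context (S : smooth_manifold R n M) (g : riemannian_metric S).

Definition inner (i : chart S) (x : M) (v w : 'rV[R]_n) : R :=
  (v *m gram g i x *m w^T) 0 0.

Definition C1_at (c : R -> M) (t : R) : Prop :=
  {for t, continuous c} /\
  forall i : chart S, chart_dom i (c t) ->
    (\forall s \near t, derivable (chart_map i \o c) s 1) /\
    {for t, continuous (derive1 (chart_map i \o c))}.

(* By gram_compat, the choice of the chart around c t is immaterial. *)
Definition speed (c : R -> M) (t : R) : R :=
  let i := chart_at S (c t) in
  let v := derive1 (chart_map i \o c) t in Num.sqrt (inner i (c t) v v).

Definition arc_length (a b : R) (c : R -> M) : R :=
  \int[lebesgue_measure]_(t in `[a, b]) speed c t.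

(* pw_curve p q l: some piecewise C^1 curve from p to q has length l.  Such a
   curve is a finite concatenation of curves on compact intervals, each of them
   C^1 up to the endpoints, i.e. the restriction of a curve defined on R which
   is C^1 at every point of the interval, endpoints included. *)
Inductive pw_curve : M -> M -> R -> Prop :=
| pw_C1 (a b : R) (c : R -> M) : a < b ->
    (forall t, a <= t <= b -> C1_at c t) ->
    pw_curve (c a) (c b) (arc_length a b c)
| pw_cat (p q r : M) (l1 l2 : R) :
    pw_curve p q l1 -> pw_curve q r l2 -> pw_curve p r (l1 + l2).

(* On a connected manifold the set below is nonempty, so that this infimum in
   R is the Riemannian distance. *)
Definition riem_dist (p q : M) : R := inf [set l | pw_curve p q l].

End Curves.

Section Maps.
Context (R : realType) (n : nat) (M N : topologicalType).
Context (SM : smooth_manifold R n M) (SN : smooth_manifold R n N).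
Context (gM : riemannian_metric SM) (gN : riemannian_metric SN).

Definition in_charts (i : chart SM) (j : chart SN) (f : M -> N) :
  'rV[R]_n -> 'rV[R]_n := chart_map j \o f \o chart_inv i.

Definition smooth_at (f : M -> N) (x : M) : Prop :=
  {for x, continuous f} /\
  forall (i : chart SM) (j : chart SN), chart_dom i x -> chart_dom j (f x) ->
    exists2 W, open_nbhs (chart_map i x) W & smooth_on W (in_charts i j f).

Definition preserves_metric_at (f : M -> N) (x : M) : Prop :=
  forall (i : chart SM) (j : chart SN), chart_dom i x -> chart_dom j (f x) ->
  forall v w : 'rV[R]_n,
    let df := 'd (in_charts i j f) (chart_map i x) in
    inner gM i x v w = inner gN j (f x) (df v) (df w).

End Maps.

Section Isometries.
Context (R : realType) (n : nat) (M N : topologicalType).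
Context (SM : smooth_manifold R n M) (SN : smooth_manifold R n N).
Context (gM : riemannian_metric SM) (gN : riemannian_metric SN).

(* f restricts to a diffeomorphism from the open set U onto the open set V
   which pulls gN back to gM. *)
Definition isometry_on (U : set M) (V : set N) (f : M -> N) : Prop :=
  [/\ open U, open V, set_bij U V f,
      forall x, U x -> smooth_at SM SN f x /\ preserves_metric_at gM gN f x
    & exists2 s : N -> M, {in U, cancel f s} &
        forall y, V y -> smooth_at SN SM s y].

Definition riemannian_isometry (f : M -> N) : Prop := isometry_on setT setT f.

Definition local_isometry (f : M -> N) : Prop :=
  forall x, exists U V, U x /\ isometry_on U V f.

End Isometries.

(* MathComp's actions are right actions. *)
Record left_action (gT : finGroupType) (T : Type) := LeftAction {
  lact :> gT -> T -> T;
  lact1 : forall x, lact 1%g x = x;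
  lactM : forall h k x, lact (h * k)%g x = lact h (lact k x)
}.

Section OrbitSpace.
Context (gT : finGroupType) (T : topologicalType) (a : left_action gT T).

Definition orbit_rel : rel T := fun x y => [exists h, y == a h x].

Lemma orbit_rel_refl : reflexive orbit_rel.
Proof. by move=> x; apply/existsP; exists 1%g; rewrite lact1. Qed.

Lemma orbit_rel_sym : symmetric orbit_rel.
Proof.
suff H x y : orbit_rel x y -> orbit_rel y x by move=> x y; apply/idP/idP => /H.
case/existsP=> h /eqP ->; apply/existsP; exists h^-1%g.
by rewrite -lactM mulVg lact1.
Qed.

Lemma orbit_rel_trans : transitive orbit_rel.
Proof.
move=> y x z /existsP[h /eqP ->] /existsP[k /eqP ->].
by apply/existsP; exists (k * h)%g; rewrite lactM.
Qed.

Definition orbit_equiv : equiv_rel T :=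
  EquivRel orbit_rel orbit_rel_refl orbit_rel_sym orbit_rel_trans.

Definition orbit_space : topologicalType :=
  quotient_topology {eq_quot orbit_equiv}%qT.

Definition quo (x : T) : orbit_space := (\pi_orbit_space x)%qT.

End OrbitSpace.

Definition min_displacement (R : realType) (n : nat) (M : topologicalType)
    (S : smooth_manifold R n M) (g : riemannian_metric S)
    (gT : finGroupType) (a : left_action gT M) : R :=
  inf [set riem_dist g p (a h p) | p in [set: M]
                                 & h in [set h : gT | h != 1%g]].

Definition minimizers (R : realType) (T : Type) (f : T -> R) : set T :=
  [set x | forall y, f x <= f y].

Section FrechetMeans.
Context (R : realType) (n : nat) (gT : finGroupType) (Mt : topologicalType).
Context (a : left_action gT Mt).

Definition frechet_mean (S : smooth_manifold R n (orbit_space a))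
    (g : riemannian_metric S) (N : nat) (Q : 'I_N -> orbit_space a) :
    set (orbit_space a) :=
  minimizers (fun p => N%:R^-1 * \sum_(i < N) riem_dist g p (Q i) ^+ 2).

(* The fibres of quo are finite and nonempty, so this infimum is a minimum. *)
Definition dist_evt (St : smooth_manifold R n Mt) (gt : riemannian_metric St)
    (q : orbit_space a) (pt : Mt) : R :=
  inf [set riem_dist gt qt pt | qt in quo a @^-1` [set q]].

Definition equivariant_frechet_mean (St : smooth_manifold R n Mt)
    (gt : riemannian_metric St) (N : nat) (Q : 'I_N -> orbit_space a) :
    set Mt :=
  minimizers (fun pt => N%:R^-1 * \sum_(i < N) dist_evt gt (Q i) pt ^+ 2).

Definition unique_up_to_action (A : set Mt) : Prop :=
  A !=set0 /\ forall x y, A x -> A y -> exists h : gT, y = a h x.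

End FrechetMeans.

(* Main.v *)
Require Import Defs.
From mathcomp Require Import all_boot all_order all_algebra fingroup.
From mathcomp Require Import generic_quotient.
From mathcomp Require Import all_classical all_reals all_analysis.
Set Implicit Arguments.
Unset Strict Implicit.
Unset Printing Implicit Defensive.
Import Order.TTheory GRing.Theory Num.Theory.
Import numFieldNormedType.Exports.
Local Open Scope classical_set_scope.
Local Open Scope ring_scope.

(** The distance on the quotient is the equivariant distance:
    d(quo pt, q) is the infimum of the distances from pt to the points of the
    fibre of q (lemma riem_dist_quotient).  Hence the cost whose minimizers are
    the equivariant Frechet means is the Frechet cost composed with quo; since
    quo is onto and its fibres are the orbits of the group, both parts of the
    theorem follow by set-theoretic bookkeeping.

    To compare the distances, it suffices to see that the piecewise C^1 curves
    from quo pt to q have exactly the same lengths as those from pt to some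
    point of the fibre of q.  In one direction a curve upstairs is projected: a
    smooth map that preserves the metric preserves speeds (speed_comp), hence
    lengths (pw_curve_map).  In the other direction a curve downstairs is
    lifted (pw_curve_lift): around each time the curve stays in an open set on
    which the local isometry has a smooth section, so that a short piece lifts,
    and a deck transformation moves the lift to any prescribed starting point;
    an induction along the interval (interval_chain) chains the short lifts.
    Chaining needs the length to be additive, which rests on the continuity of
    the speed (speed_continuous), itself a consequence of the independence of
    the speed from the chart, i.e. of speed_comp for the identity map.

    Two more facts are used.  The two costs list the endpoints of the distance
    in opposite orders, so lengths must be invariant under reversal
    (pw_curve_sym).  The infimum of an empty set of reals is 0, so curves
    between any two points must exist upstairs; this is where connectedness
    enters (connected_pw_curve). *)

(** * Calculus along curves in a normed space *)

Lemma cvg_finsum (R : realType) (W : normedModType R) (I : finType) (T : Type)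
    (F : set_system T) (FF : Filter F) (f : I -> T -> W) (a : I -> W) :
  (forall i, f i @ F --> a i) -> \sum_i f i x @[x --> F] --> \sum_i a i.
Proof.
move=> fa; apply: (@cvg_big W I +%R 0 predT _ T F _ f a FF) => //.
exact: add_continuous.
Qed.

Lemma derivable_comp_diff (R : realType) (V W : normedModType R)
    (phi : V -> W) (c : R -> V) (t : R) :
  differentiable phi (c t) -> derivable c t 1 ->
  derivable (phi \o c) t 1 /\
  derive1 (phi \o c) t = 'd phi (c t) (derive1 c t).
Proof.
move=> dphi /derivable1_diffP dc.
have dpc : differentiable (phi \o c) t by exact: differentiable_comp.
split; first exact/derivable1_diffP.
by rewrite derive1E deriveE// diff_comp//= derive1E deriveE.
Qed.

Lemma derivable_continuous (R : realType) (V : normedModType R)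
    (c : R -> V) (t : R) : derivable c t 1 -> {for t, continuous c}.
Proof. by move=> /derivable1_diffP/differentiable_continuous. Qed.

Lemma near_eq_derive1 (R : realType) (V : normedModType R) (f g : R -> V)
  (t : R) : {near t, f =1 g} -> derive1 f t = derive1 g t.
Proof. by move=> fg; rewrite !derive1E; exact: near_eq_derive. Qed.

(** The condition that C1_at imposes on the expression of a curve in a
    chart. *)
Definition C1_near (R : realType) (V : normedModType R) (c : R -> V) (t : R) :=
  (\forall s \near t, derivable c s 1) /\ {for t, continuous (derive1 c)}.

Lemma C1_near_eq (R : realType) (V : normedModType R) (f g : R -> V) (t : R) :
  {near t, f =1 g} -> C1_near f t -> C1_near g t.
Proof.
move=> /near_join fg [df cf]; split.
  by near=> s; apply: (@near_eq_derivable _ _ _ f); near: s.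
have E : {near t, derive1 f =1 derive1 g}.
  by near=> s; apply: near_eq_derive1; near: s.
rewrite /prop_for /continuous_at -(nbhs_singleton E).
move: cf; apply: cvg_trans; apply: near_eq_cvg.
exact: E.
Unshelve. all: by end_near. Qed.

(** By the chain rule the velocity of phi \o c is the combination of the partial
    derivatives of phi along c whose coefficients are the coordinates of the
    velocity of c; written in this way its continuity is visible, as the
    smoothness of phi is stated for directional derivatives. *)
Lemma C1_near_comp (R : realType) (n : nat) (W : normedModType R)
    (U : set 'rV[R]_n) (phi : 'rV[R]_n -> W) (c : R -> 'rV[R]_n) (t : R) :
  open_nbhs (c t) U -> smooth_on U phi -> C1_near c t -> C1_near (phi \o c) t.
Proof.
move=> oU sphi [dc cc'].
have [dphi cphi] := sphi 1%N.
have ct : {for t, continuous c} by exact/derivable_continuous/(nbhs_singleton dc).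
have cU : \forall s \near t, U (c s) by apply: ct; exact: open_nbhs_nbhs.
have chain : \forall s \near t, derivable (phi \o c) s 1 /\
    derive1 (phi \o c) s = \sum_j derive1 c s 0 j *: 'D_(delta_mx 0 j) phi (c s).
  near=> s.
  have dphis : differentiable phi (c s) by apply: dphi; near: s.
  have [|dpc ->] := derivable_comp_diff dphis; first by near: s.
  split; first exact: dpc.
  rewrite {1}[derive1 c s]row_sum_delta linear_sum.
  by apply: eq_bigr => j _; rewrite linearZ deriveE.
split; first by apply: filterS chain => s [].
have [_ E] := nbhs_singleton chain.
rewrite /prop_for /continuous_at E.
apply: (@cvg_trans _
  ((\sum_j derive1 c s 0 j *: 'D_(delta_mx 0 j) phi (c s)) @[s --> t])).
  by apply: near_eq_cvg; apply: filterS chain => s [].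
apply: (@cvg_finsum R W _ _ (nbhs t) _
  (fun j s => derive1 c s 0 j *: 'D_(delta_mx 0 j) phi (c s))
  (fun j => derive1 c t 0 j *: 'D_(delta_mx 0 j) phi (c t))) => j.
apply: cvgZ.
  exact: (cvg_comp _ _ cc' (@coord_continuous _ _ _ _ _ _)).
have H : {for c t, continuous ('D_(delta_mx 0 j) phi)} by apply: cphi; case: oU.
exact: (cvg_comp _ _ ct H).
Unshelve. all: by end_near. Qed.

Lemma derive1_oppr (R : realType) (V : normedModType R) (f : R -> V) (t : R) :
  derivable f (- t) 1 ->
  derivable (f \o -%R) t 1 /\ derive1 (f \o -%R) t = - derive1 f (- t).
Proof.
move=> df.
have [|//|d ->] := @derivable_comp_diff _ _ _ f -%R t.
  exact/derivable1_diffP.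
split; first exact: d.
have -> : derive1 (-%R : R -> R) t = - 1 by rewrite derive1E derive_val.
rewrite linearN; congr (- _).
by rewrite derive1E deriveE//; exact/derivable1_diffP.
Qed.

Lemma C1_near_oppr (R : realType) (V : normedModType R) (f : R -> V) (t : R) :
  C1_near f (- t) -> C1_near (f \o -%R) t.
Proof.
move=> [df cf].
have cN : (- x) @[x --> t] --> - t by apply: cvgN; exact: cvg_id.
have d : \forall s \near t, derivable f (- s) 1 by apply: (cN _ df).
split; first by apply: filterS d => s /derive1_oppr[].
rewrite /prop_for /continuous_at (derive1_oppr (nbhs_singleton d)).2.
apply: (@cvg_trans _ ((- derive1 f (- s)) @[s --> t])).
  by apply: near_eq_cvg; apply: filterS d => s /derive1_oppr[].
exact: (cvgN (cvg_comp _ _ cN cf)).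
Qed.

Lemma cvg_quadratic (R : realType) (n : nat) (T : Type) (F : set_system T)
    (FF : Filter F) (v : T -> 'rV[R]_n) (G : T -> 'M[R]_n)
    (v0 : 'rV[R]_n) (G0 : 'M[R]_n) :
  v @ F --> v0 -> G @ F --> G0 ->
  (fun x => (v x *m G x *m (v x)^T) 0 0) @ F --> (v0 *m G0 *m v0^T) 0 0.
Proof.
move=> cv cG.
have cij m1 m2 (H : T -> 'M[R]_(m1, m2)) (H0 : 'M[R]_(m1, m2)) i j :
    H @ F --> H0 -> (fun x => H x i j) @ F --> H0 i j.
  move=> cH; exact: (cvg_comp _ _ cH (@coord_continuous _ _ _ i j H0)).
have -> : (fun x => (v x *m G x *m (v x)^T) 0 0) =
    (fun x => \sum_i (\sum_j v x 0 j * G x j i) * v x 0 i).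
  by apply/funext => x; rewrite mxE; apply: eq_bigr => i _; rewrite !mxE.
have -> : (v0 *m G0 *m v0^T) 0 0 =
    \sum_i (\sum_j v0 0 j * G0 j i) * v0 0 i.
  by rewrite mxE; apply: eq_bigr => i _; rewrite !mxE.
apply: (@cvg_finsum R _ _ _ F _
  (fun i x => (\sum_j v x 0 j * G x j i) * v x 0 i)
  (fun i => (\sum_j v0 0 j * G0 j i) * v0 0 i)) => i.
apply: cvgM; last exact: cij.
apply: (@cvg_finsum R _ _ _ F _
  (fun j x => v x 0 j * G x j i) (fun j => v0 0 j * G0 j i)) => j.
by apply: cvgM; exact: cij.
Qed.

Lemma derive1_line (R : realType) (V : normedModType R) (u w : V) (t : R) :
  let line (s : R) := u + s *: w in derivable line t 1 /\ derive1 line t = w.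
Proof.
move=> line.
have lw : (fun h => h^-1 *: ((line \o shift t) (h *: 1) - line t)) @ 0^' --> w.
  apply: (@cvg_trans _ (w @[_ --> (0 : R)^'])); last exact: cvg_cst.
  apply: near_eq_cvg; near=> h.
  rewrite /= /line opprD addrACA subrr add0r -scalerBl addrK scalerA.
  rewrite [_%:A]mulr1 mulVf ?scale1r//.
  by near: h; exact: nbhs_dnbhs_neq.
by rewrite derive1E; split; [exact: cvgP lw | exact: cvg_lim lw].
Unshelve. all: by end_near. Qed.

(** * Curves on manifolds and their speed *)

Section Manifold.
Context (R : realType) (n : nat) (M : topologicalType).
Context (S : smooth_manifold R n M).
Implicit Types (c : R -> M) (t : R) (x : M) (i j : chart S).

Lemma open_overlap i j : open (chart_map i @` (chart_dom i `&` chart_dom j)).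
Proof.
rewrite openE => _ [x [xi xj] <-].
have ni : nbhs (chart_map i x) (chart_map i @` chart_dom i).
  apply: open_nbhs_nbhs; split; first exact: open_chart_codom.
  by exists x.
have nj : nbhs (chart_map i x) (chart_inv i @^-1` chart_dom j).
  apply: chart_inv_continuous => //; rewrite chart_mapK//.
  by apply: open_nbhs_nbhs; split=> //; exact: open_chart_dom.
apply: filterS2 ni nj => _ [y yi <-]; rewrite /preimage/= chart_mapK// => yj.
by exists y.
Qed.

(** Changes of charts are the local expressions of the identity: the statements
    below about a smooth map f, applied to f = id, say that the choice of charts
    is immaterial. *)
Lemma smooth_at_id x : smooth_at S S id x.
Proof.
split=> [|i j xi xj]; first exact: cvg_id.
exists (chart_map i @` (chart_dom i `&` chart_dom j)).
  by split; [exact: open_overlap | exists x].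
exact: transition_smooth.
Qed.

Lemma near_chart_dom c t i : {for t, continuous c} -> chart_dom i (c t) ->
  \forall s \near t, chart_dom i (c s).
Proof.
by move=> ct di; apply: ct; apply: open_nbhs_nbhs; split=> //;
  exact: open_chart_dom.
Qed.

End Manifold.

Section Maps.
Context (R : realType) (n : nat) (M N : topologicalType).
Context (SM : smooth_manifold R n M) (SN : smooth_manifold R n N).
Implicit Types (f : M -> N) (c : R -> M) (t : R).

Lemma in_charts_near f c t (i : chart SM) (j : chart SN) :
  {for t, continuous c} -> chart_dom i (c t) ->
  {near t, in_charts i j f \o (chart_map i \o c) =1 chart_map j \o (f \o c)}.
Proof.
move=> cc ci; apply: filterS (near_chart_dom cc ci) => s cs.
by rewrite /in_charts /= chart_mapK.
Qed.

(** Near t the curve f \o c is read in the chart j as the local expression of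
    f applied to c read in a single chart i. *)
Lemma C1_at_comp f c t :
  smooth_at SM SN f (c t) -> C1_at SM c t -> C1_at SN (f \o c) t.
Proof.
move=> [fc fs] [cc dc]; split=> [|j fj]; first exact: (cvg_comp _ _ cc fc).
have ci := chart_dom_at SM (c t).
have [W oW sW] := fs _ _ ci fj.
apply: C1_near_eq (in_charts_near f j cc ci) _.
exact: C1_near_comp oW sW (dc _ ci).
Qed.

Context (gM : riemannian_metric SM) (gN : riemannian_metric SN).

Lemma velocity_comp f c t (i : chart SM) (j : chart SN) :
  smooth_at SM SN f (c t) -> C1_at SM c t ->
  chart_dom i (c t) -> chart_dom j (f (c t)) ->
  derive1 (chart_map j \o (f \o c)) t =
  'd (in_charts i j f) (chart_map i (c t)) (derive1 (chart_map i \o c) t).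
Proof.
move=> [_ fs] [cc dc] ci cj.
rewrite -(near_eq_derive1 (in_charts_near f j cc ci)).
have [W [oW Wc] /(_ 1%N)[dW _]] := fs _ _ ci cj.
have [] := @derivable_comp_diff _ _ _ (in_charts i j f) (chart_map i \o c) t.
- exact: dW.
- exact: nbhs_singleton (dc _ ci).1.
- by [].
Qed.

Lemma sqspeed_comp f c t (i : chart SM) (j : chart SN) :
  smooth_at SM SN f (c t) -> preserves_metric_at gM gN f (c t) ->
  C1_at SM c t -> chart_dom i (c t) -> chart_dom j (f (c t)) ->
  let v := derive1 (chart_map i \o c) t in
  let w := derive1 (chart_map j \o (f \o c)) t in
  inner gN j (f (c t)) w w = inner gM i (c t) v v.
Proof.
move=> fs fm cc ci cj /=; rewrite (velocity_comp fs cc ci cj).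
by rewrite -fm.
Qed.

Lemma speed_comp f c t :
  smooth_at SM SN f (c t) -> preserves_metric_at gM gN f (c t) ->
  C1_at SM c t -> speed gN (f \o c) t = speed gM c t.
Proof.
move=> fs fm cc; rewrite /speed; congr Num.sqrt.
by apply: sqspeed_comp => //; exact: chart_dom_at.
Qed.

End Maps.

Section Curves.
Context (R : realType) (n : nat) (M : topologicalType).
Context (S : smooth_manifold R n M) (g : riemannian_metric S).
Implicit Types (c : R -> M) (t : R).

Lemma preserves_metric_id x : preserves_metric_at g g id x.
Proof. by move=> i j xi xj v w; exact: gram_compat. Qed.

(** The speed is defined with a chart that varies with c t; it can be computed
    in any other chart, in particular in one that is fixed near t. *)
Lemma speedE c t (i : chart S) : C1_at S c t -> chart_dom i (c t) ->
  let v := derive1 (chart_map i \o c) t in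
  speed g c t = Num.sqrt (inner g i (c t) v v).
Proof.
move=> cc ci /=; rewrite /speed; congr Num.sqrt.
apply: (sqspeed_comp (f := id)) => //.
- exact: smooth_at_id.
- exact: preserves_metric_id.
- exact: chart_dom_at.
Qed.

Lemma speed_near_eq c1 c2 t :
  {near t, c1 =1 c2} -> speed g c1 t = speed g c2 t.
Proof.
move=> e; rewrite /speed (nbhs_singleton e).
rewrite (@near_eq_derive1 _ _ _ (chart_map (chart_at S (c2 t)) \o c2))//.
by apply: filterS e => s /= ->.
Qed.

(** Restricting to the interval matters: outside of it the curve need not be
    C^1, and its speed is then arbitrary. *)
Lemma speed_continuous a b c : (forall t, a <= t <= b -> C1_at S c t) ->
  {within `[a, b], continuous (speed g c)}.
Proof.
move=> cC; apply/subspace_continuousP => t tab.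
have ct : C1_at S c t by apply: cC; move: tab; rewrite /= in_itv.
have [cc dc] := ct.
set i := chart_at S (c t).
have ci : chart_dom i (c t) := chart_dom_at S (c t).
pose v := derive1 (chart_map i \o c).
change (speed g c s @[s --> within `[a, b] (nbhs t)] --> speed g c t).
rewrite (speedE ct ci) -/(v t).
apply: (@cvg_trans _ ((Num.sqrt (inner g i (c s) (v s) (v s)))
    @[s --> within `[a, b] (nbhs t)])).
  apply: near_eq_cvg; rewrite near_withinE.
  apply: filterS (near_chart_dom cc ci) => s cs sab.
  by apply/esym/speedE => //; apply: cC; move: sab; rewrite /= in_itv.
apply: cvg_within_filter.
apply: cvg_comp; last exact: sqrt_continuous.
apply: (@cvg_quadratic _ _ _ (nbhs t) _ v (gram g i \o c)).
  exact: (dc _ ci).2.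
have gi : {for chart_map i (c t), continuous (gram g i \o chart_inv i)}.
  by apply: (gram_smooth g i 0); exists (c t).
have := cvg_comp _ _ (derivable_continuous (nbhs_singleton (dc _ ci).1)) gi.
rewrite /= chart_mapK//; apply: cvg_trans; apply: near_eq_cvg.
by apply: filterS (near_chart_dom cc ci) => s cs /=; rewrite chart_mapK.
Qed.

Lemma speed_integrable a b c : (forall t, a <= t <= b -> C1_at S c t) ->
  lebesgue_measure.-integrable `[a, b] (EFin \o speed g c).
Proof.
move=> /speed_continuous cC.
by apply: continuous_compact_integrable; [exact: segment_compact|exact: cC].
Qed.

Lemma eq_arc_length (N : topologicalType) (S' : smooth_manifold R n N)
    (g' : riemannian_metric S') a b c (c' : R -> N) :
  (forall t, a <= t <= b -> speed g c t = speed g' c' t) ->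
  arc_length g a b c = arc_length g' a b c'.
Proof.
by move=> e; apply: eq_Rintegral => t; rewrite inE /= in_itv/=; exact: e.
Qed.

Lemma arc_length_ge0 a b c : 0 <= arc_length g a b c.
Proof. by apply: Rintegral_ge0 => t _; exact: sqrtr_ge0. Qed.

Lemma arc_length_cat a b d c : a < b -> b < d ->
  (forall t, a <= t <= d -> C1_at S c t) ->
  arc_length g a d c = arc_length g a b c + arc_length g b d c.
Proof.
move=> ab bd cC; apply/eqP; rewrite addrC -subr_eq; apply/eqP.
have ci := speed_integrable cC.
rewrite /arc_length Rintegral_itvB ?bnd_simp ?ltW//.
rewrite Rintegral_itv_obnd_cbnd//; apply: integrableS ci => //.
by apply: subset_itvScc => //=; rewrite bnd_simp ?ltW.
Qed.

End Curves.

(** * Lengths of piecewise C^1 curves *)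

Section PiecewiseCurves.
Context (R : realType) (n : nat) (M : topologicalType).
Context (S : smooth_manifold R n M) (g : riemannian_metric S).
Implicit Types (c : R -> M) (t : R).

Lemma C1_at_oppr c t : C1_at S c (- t) -> C1_at S (c \o -%R) t.
Proof.
move=> [cc dc]; split=> [|i ci].
  have cN : (- x) @[x --> t] --> - t by apply: cvgN; exact: cvg_id.
  exact: (cvg_comp _ _ cN cc).
exact: C1_near_oppr (dc _ ci).
Qed.

Lemma speed_oppr c t : C1_at S c (- t) ->
  speed g (c \o -%R) t = speed g c (- t).
Proof.
move=> [cc dc]; rewrite /speed /=.
have [d _] := dc _ (chart_dom_at S (c (- t))).
have -> := (derive1_oppr (nbhs_singleton d)).2.
by rewrite /inner linearN /= mulmxN mulNmx mulNmx opprK.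
Qed.

Lemma arc_length_oppr a b c : a < b -> (forall t, a <= t <= b -> C1_at S c t) ->
  arc_length g (- b) (- a) (c \o -%R) = arc_length g a b c.
Proof.
move=> ab cC; apply: (congr1 fine).
have ba : - b <= - a by rewrite lerN2 ltW.
have cs : {within `[- - a, - - b], continuous (speed g c)}.
  by rewrite !opprK; exact: speed_continuous.
transitivity (\int[lebesgue_measure]_(t in `[(- b)%R, (- a)%R])
    ((speed g c \o -%R) t)%:E)%E.
  apply: eq_integral => t; rewrite inE/= in_itv/= => /andP[bt ta].
  by rewrite speed_oppr//; apply: cC; rewrite lerNr ta lerNl bt.
by rewrite -(integration_by_substitution_oppr ba cs) !opprK.
Qed.

Lemma pw_curve_sym p q l : pw_curve g p q l -> pw_curve g q p l.
Proof.
elim=> {p q l} [a b c ab cC|p q r l1 l2 _ pq _ qr]; last first.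
  by rewrite addrC; exact: pw_cat qr pq.
rewrite -(arc_length_oppr ab cC).
have := @pw_C1 _ _ _ _ g (- b) (- a) (c \o -%R).
rewrite /= !opprK; apply; first by rewrite ltrN2.
move=> t /andP[bt ta]; apply: C1_at_oppr; apply: cC.
by rewrite lerNr ta lerNl bt.
Qed.

Lemma pw_curve_ge0 p q l : pw_curve g p q l -> 0 <= l.
Proof.
by elim=> [*|*]; [exact: arc_length_ge0 | exact: addr_ge0].
Qed.

Lemma pw_curve_map (N : topologicalType) (SN : smooth_manifold R n N)
    (gN : riemannian_metric SN) (f : M -> N) :
  (forall x, smooth_at S SN f x /\ preserves_metric_at g gN f x) ->
  forall p q l, pw_curve g p q l -> pw_curve gN (f p) (f q) l.
Proof.
move=> fP p q l; elim=> {p q l} [a b c ab cC|p q r l1 l2 _ pq _ qr]; last first.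
  exact: pw_cat pq qr.
rewrite (@eq_arc_length _ _ _ _ g _ _ gN _ _ c (f \o c)); last first.
  by move=> t /cC ct; rewrite (speed_comp _ (fP _).2)//; exact: (fP _).1.
have := @pw_C1 _ _ _ _ gN a b (f \o c) ab; apply => t /cC ct.
exact: C1_at_comp (fP (c t)).1 ct.
Qed.

Lemma C1_at_segment (i : chart S) (u v : 'rV[R]_n) t :
  let line s := u + s *: (v - u) in
  (chart_map i @` chart_dom i) (line t) -> C1_at S (chart_inv i \o line) t.
Proof.
move=> line [x xi xE].
have dl (s : R) : derivable line s 1 /\ derive1 line s = v - u.
  exact: derive1_line.
have lc : C1_near line t.
  split; first by near=> s; exact: (dl s).1.
  have -> : derive1 line = cst (v - u) by apply/funext => s; exact: (dl s).2.
  exact: cvg_cst.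
have invc : {for line t, continuous (chart_inv (s := S) i)}.
  by rewrite -xE; exact: chart_inv_continuous.
have lx : chart_inv i (line t) = x by rewrite -xE chart_mapK.
split=> [|j xj].
  exact: (cvg_comp _ _ (derivable_continuous (dl t).1) invc).
have {}xj : chart_dom j x by rewrite -lx.
apply: (C1_near_comp (phi := chart_map j \o chart_inv i) _ _ lc);
  last exact: transition_smooth.
by split; [exact: open_overlap | exists x].
Unshelve. all: by end_near. Qed.

(** In a chart around x, the segment to y stays in a ball contained in the image
    of the chart. *)
Lemma pw_curve_locally x : \forall y \near x, exists l, pw_curve g x y l.
Proof.
set i := chart_at S x; have xi : chart_dom i x := chart_dom_at S x.
have : nbhs (chart_map i x) (chart_map i @` chart_dom i).
  apply: open_nbhs_nbhs; split; first exact: open_chart_codom.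
  by exists x.
move=> /nbhs_ballP[e e0 eW].
have cx : {for x, continuous (chart_map i)} by exact: chart_map_continuous.
near=> y.
have yi : chart_dom i y.
  by near: y; apply: open_nbhs_nbhs; split=> //; exact: open_chart_dom.
have yB : ball (chart_map i x) e (chart_map i y).
  by near: y; apply: cx; exact: nbhsx_ballx.
pose line (s : R) := chart_map i x + s *: (chart_map i y - chart_map i x).
have lB (s : R) : 0 <= s <= 1 -> (chart_map i @` chart_dom i) (line s).
  move=> /andP[s0 s1]; apply: eW.
  move: yB; rewrite -!ball_normE /ball_ /= opprD addNKr normrN normrZ ger0_norm//.
  rewrite distrC; apply: le_lt_trans.
  by rewrite ler_piMl.
exists (arc_length g 0 1 (chart_inv i \o line)).
have l0 : (chart_inv i \o line) 0 = x.
  by rewrite /= /line scale0r addr0 chart_mapK.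
have l1 : (chart_inv i \o line) 1 = y.
  by rewrite /= /line scale1r addrC subrK chart_mapK.
have := @pw_C1 _ _ _ _ g 0 1 (chart_inv i \o line) ltr01.
rewrite l0 l1; apply => t /lB; exact: C1_at_segment.
Unshelve. all: by end_near. Qed.

(** The set of points reachable from p is open, and so is its complement, as
    curves can be concatenated and reversed. *)
Lemma connected_pw_curve : connected [set: M] ->
  forall p q, exists l, pw_curve g p q l.
Proof.
move=> Mc p q; pose A := [set y | exists l, pw_curve g p y l].
suff : A = setT by move=> AT; have : A q by rewrite AT.
have oA : open A.
  rewrite openE => y [l py]; apply: filterS (pw_curve_locally y) => z [l' yz].
  by exists (l + l'); exact: pw_cat py yz.
have oAC : open (~` A).
  rewrite openE => y Ay; apply: filterS (pw_curve_locally y) => z [l' yz] [l pz].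
  by apply: Ay; exists (l + l'); exact: pw_cat pz (pw_curve_sym yz).
apply: Mc; first by exists p; exact: nbhs_singleton (pw_curve_locally p).
- by exists A => //; rewrite setTI.
- by exists A; [rewrite -[A]setCK; exact: open_closedC | rewrite setTI].
Qed.

End PiecewiseCurves.

(** * The orbit space *)

Lemma orbit_quoP (gT : finGroupType) (T : topologicalType)
    (a : left_action gT T) (x y : T) :
  quo a x = quo a y <-> exists h, y = a h x.
Proof.
split=> [/(@eqmodP _ (orbit_equiv a) x y)/existsP[h /eqP yE]|[h yE]].
  by exists h.
apply/(@eqmodP _ (orbit_equiv a) x y)/existsP.
by exists h; apply/eqP.
Qed.

Lemma quo_surj (gT : finGroupType) (T : topologicalType)
    (a : left_action gT T) (p : orbit_space a) : exists x, quo a x = p.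
Proof. by exists (repr p); rewrite /quo reprK. Qed.

(** * Lifting curves through a local isometry *)

(** Consider the supremum of the times t such that L a t: the local hypothesis
    around it shows that L a holds at the supremum, and even beyond it when it
    is smaller than b. *)
Lemma interval_chain (R : realType) (L : R -> R -> Prop) (a b : R) : a < b ->
  (forall u v w, a <= u -> u < v -> v < w -> w <= b -> L u v -> L v w -> L u w) ->
  (forall t, a <= t <= b -> exists2 e : R, 0 < e & forall u v,
     a <= u -> u < v -> v <= b -> t - e < u -> v < t + e -> L u v) ->
  L a b.
Proof.
move=> ab Lcat Lloc.
(* The case t = a makes A nonempty. *)
pose A := [set t | a <= t <= b /\ (t = a \/ L a t)].
have Aa : A a by split; [rewrite lexx ltW | left].
have ubA : ubound A b by move=> t [/andP[]].
have hA : has_sup A by split; [exists a | exists b].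
have leas : a <= sup A by apply: ub_le_sup; [exists b|].
have sb : sup A <= b by apply: sup_le_ub => //; exists a.
have [|e e0 eL] := Lloc (sup A); first by rewrite leas sb.
have [t [tab tA] et] := sup_adherent e0 hA.
have [at_ tb] := andP tab.
have ts : t <= sup A by apply: ub_le_sup => //; exists b.
(* w would be an element of A beyond its supremum, unless w = b. *)
pose w := Num.min b (sup A + e / 2).
have e20 : 0 < e / 2 by rewrite divr_gt0.
have wb : w <= b by rewrite ge_min lexx.
have ws : w <= sup A + e / 2 by rewrite ge_min lexx orbT.
have wE : w <= sup A -> w = b.
  by rewrite /w; case: (leP b) => // _; rewrite gerDl leNgt e20.
have [tw|wt] := ltP t w; last first.
  have wbE := wE (le_trans wt ts).
  have tE : t = b by apply/le_anti; rewrite tb -wbE wt.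
  by case: tA => [ta|]; [move: ab; rewrite -ta tE ltxx | rewrite tE].
have Ltw : L t w.
  apply: eL => //; apply: le_lt_trans ws _.
  by rewrite ltrD2l ltr_pdivrMr// ltr_pMr// ltr1n.
have Law : L a w.
  case: tA => [<-//|Lat].
  have [ta|] := eqVneq t a; first by rewrite -ta.
  by move=> tna; apply: (Lcat _ t) => //; rewrite lt_neqAle eq_sym tna.
have : w <= sup A.
  apply: ub_le_sup; first by exists b.
  by split; [rewrite wb (le_trans at_ (ltW tw)) | right].
by move/wE => <-.
Qed.

(** The hypotheses on f abstract the quotient map of a free isometric action of
    a finite group, the maps h of f_deck being the translations by elements of
    the group; f_deck is what allows a lift to start at a prescribed point of
    the fibre. *)
Section Lifting.
Context (R : realType) (n : nat) (Mt M : topologicalType).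
Context (St : smooth_manifold R n Mt) (gt : riemannian_metric St).
Context (S : smooth_manifold R n M) (g : riemannian_metric S).
Context (f : Mt -> M) (f_surj : forall p, exists x, f x = p).
Context (f_isom : local_isometry gt g f).
Context (f_deck : forall x y, f x = f y -> exists h : Mt -> Mt,
  [/\ riemannian_isometry gt gt h, forall z, f (h z) = f z & h x = y]).

Lemma local_isometry_smooth x :
  smooth_at St S f x /\ preserves_metric_at gt g f x.
Proof. by have [U [V [Ux [_ _ _ + _]]]] := f_isom x; exact. Qed.

(** The lift is the local section s composed with the curve, moved to start at x
    by a deck transformation; thus the radius e can be chosen before the piece
    and its starting point. *)
Lemma pw_curve_lift_locally (a b : R) (c : R -> M) t :
  (forall t, a <= t <= b -> C1_at S c t) -> a <= t <= b ->
  exists2 e : R, 0 < e & forall u v,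
     a <= u -> u < v -> v <= b -> t - e < u -> v < t + e ->
  forall x, f x = c u ->
    exists2 y, f y = c v & pw_curve gt x y (arc_length g u v c).
Proof.
move=> cC tab.
have [x0 x0t] := f_surj (c t).
have [U [V [Ux0 [oU oV [fUV _ fV] fP [s fK sP]]]]] := f_isom x0.
have sV y : V y -> U (s y) /\ f (s y) = y.
  by case/fV => x Ux <-; rewrite fK ?inE.
have : \forall r \near t, V (c r).
  have [cc _] := cC _ tab.
  by apply: cc; apply: open_nbhs_nbhs; split; rewrite // -x0t; exact: fUV.
move=> /nbhs_ballP[e e0 eV]; exists e => // u v au uv vb tu vt x xu.
have cV r : u <= r <= v -> V (c r).
  move=> /andP[ur rv]; apply: eV; rewrite -ball_normE /ball_ /= ltr_distlC.
  by rewrite (lt_le_trans tu)//= (le_lt_trans rv).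
have cC' r : u <= r <= v -> C1_at S c r.
  by move=> /andP[ur rv]; apply: cC; rewrite (le_trans au)// (le_trans rv).
have scC r : u <= r <= v -> C1_at St (s \o c) r.
  by move=> ruv; apply: C1_at_comp; [exact/sP/cV | exact: cC'].
(* The section s is not known to preserve the metric, but f does, and
   f \o (s \o c) is c near r. *)
have sc_speed r : u <= r <= v -> speed g c r = speed gt (s \o c) r.
  move=> ruv; have [fs fm] := local_isometry_smooth (s (c r)).
  rewrite -(speed_comp fs fm (scC _ ruv)); apply: speed_near_eq.
  have [cc _] := cC' _ ruv.
  have Vr : \forall r' \near r, V (c r').
    by apply: cc; apply: open_nbhs_nbhs; split=> //; exact: cV.
  by apply: filterS Vr => r' /sV[_ /= ->].
have [uuv vuv] : u <= u <= v /\ u <= v <= v by rewrite !lexx ltW.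
have [|h [h_isom fh hx]] := @f_deck (s (c u)) x.
  by rewrite xu; exact: (sV _ (cV _ uuv)).2.
exists (h (s (c v))); first by rewrite fh (sV _ (cV _ vuv)).2.
rewrite -hx (eq_arc_length sc_speed).
apply: (pw_curve_map (gN := gt)) (pw_C1 gt uv scC).
by move=> z; have [_ _ _ + _] := h_isom; exact.
Qed.

Lemma pw_curve_lift p q l : pw_curve g p q l ->
  forall x, f x = p -> exists2 y, f y = q & pw_curve gt x y l.
Proof.
elim=> {p q l} [a b c ab cC|p q r l1 l2 _ IH1 _ IH2] x xp; last first.
  have [y yq xy] := IH1 _ xp; have [z zr yz] := IH2 _ yq.
  by exists z => //; exact: pw_cat xy yz.
apply: (@interval_chain R (fun u v => forall x, f x = c u ->
  exists2 y, f y = c v & pw_curve gt x y (arc_length g u v c)) a b) => //.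
- move=> u v w au uv vw wb Luv Lvw z0 zu.
  have [y yv xy] := Luv _ zu; have [z zw yz] := Lvw _ yv.
  exists z => //; rewrite (arc_length_cat g uv vw); first exact: pw_cat xy yz.
  move=> r /andP[ur rw]; apply: cC.
  by rewrite (le_trans au ur) (le_trans rw wb).
- by move=> t tab; exact: pw_curve_lift_locally.
Qed.

(** The reversal compensates for the order of the endpoints: lifts start at x,
    whereas the equivariant distance goes from the fibre to x. *)
Lemma pw_curve_quotient x q l :
  pw_curve g (f x) q l <-> exists2 y, f y = q & pw_curve gt y x l.
Proof.
split=> [/pw_curve_lift /(_ x erefl)[y yq xy]|[y <- yx]].
  by exists y => //; exact: pw_curve_sym.
by apply: pw_curve_sym; exact: pw_curve_map local_isometry_smooth _ _ _ yx.
Qed.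

(** Both sides are infima over the same set of lengths, which the right-hand
    side groups by the end point in the fibre. *)
Lemma riem_dist_quotient (Mt_conn : connected [set: Mt]) x q :
  riem_dist g (f x) q = inf [set riem_dist gt y x | y in f @^-1` [set q]].
Proof.
have ge0 (M' : topologicalType) (S' : smooth_manifold R n M')
    (g' : riemannian_metric S') p r : lbound [set l | pw_curve g' p r l] 0.
  by move=> l; exact: pw_curve_ge0.
have ne p r : [set l | pw_curve gt p r l] !=set0.
  by have [l] := connected_pw_curve gt Mt_conn p r; exists l.
have [z zq] := f_surj q.
apply/le_anti/andP; split.
  apply: lb_le_inf; first by exists (riem_dist gt z x); exists z.
  move=> _ [y yq <-]; apply: lb_le_inf => // l yxl.
  apply: ge_inf; first by exists 0; exact: ge0.
  by apply/pw_curve_quotient; exists y.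
apply: lb_le_inf.
  by have [l zx] := ne z x; exists l; apply/pw_curve_quotient; exists z.
move=> l /pw_curve_quotient[y yq yx].
apply: (@le_trans _ _ (riem_dist gt y x)).
  apply: ge_inf; last by exists y.
  by exists 0 => _ [w _ <-]; exact: lb_le_inf.
by apply: ge_inf yx; exists 0; exact: ge0.
Qed.

End Lifting.

Theorem proposition7p4 (R : realType) (n : nat)
  (Mt : topologicalType) (St : smooth_manifold R n Mt)
  (gt : riemannian_metric St) (Mt_conn : connected [set: Mt])
  (gT : finGroupType) (gT_gt1 : (1 < #|gT|)%N) (a : left_action gT Mt)
  (a_isom : forall h : gT, riemannian_isometry gt gt (a h))
  (beta_gt0 : 0 < min_displacement gt a)
  (S : smooth_manifold R n (orbit_space a)) (g : riemannian_metric S)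
  (quo_isom : local_isometry gt g (quo a))
  (N : nat) (N_gt0 : (0 < N)%N) (Q : 'I_N -> orbit_space a) :
  let FM := frechet_mean g Q in
  let EFM := equivariant_frechet_mean gt Q in
  ((forall pt : Mt, let p := quo a pt in
      (FM p <-> EFM pt) /\ (EFM pt <-> quo a @^-1` [set p] `<=` EFM)) /\
   EFM = quo a @^-1` FM /\ quo a @` EFM = FM) /\
  ((exists! p, FM p) <-> unique_up_to_action a EFM).
Proof.
move=> FM EFM.
have deck x y : quo a x = quo a y -> exists h : Mt -> Mt,
    [/\ riemannian_isometry gt gt h, forall z, quo a (h z) = quo a z & h x = y].
  move=> /orbit_quoP[h yE]; exists (a h); split=> // z.
  by apply/esym/orbit_quoP; exists h.
have distE pt q : dist_evt gt q pt = riem_dist g (quo a pt) q.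
  by rewrite (riem_dist_quotient (@quo_surj _ _ a) quo_isom deck Mt_conn).
have costE pt : \sum_(i < N) dist_evt gt (Q i) pt ^+ 2 =
    \sum_(i < N) riem_dist g (quo a pt) (Q i) ^+ 2.
  by apply: eq_bigr => i _; rewrite distE.
have FME pt : EFM pt <-> FM (quo a pt).
  split=> m y; last by rewrite !costE; exact: m.
  by have [x <-] := quo_surj y; rewrite -!costE; exact: m.
have EFME : EFM = quo a @^-1` FM by apply/seteqP; split=> x /FME.
split; first split.
- move=> pt p; split; first by split=> /FME.
  split=> [/FME m x xp|]; last exact.
  by apply/FME; rewrite xp.
- split=> //; apply/seteqP; split=> [_ [x /FME m <-]//|p].
  by have [x <-] := quo_surj p => m; exists x => //; apply/FME.
split=> [[p [pm p_uniq]]|[[x xm] EFM_uniq]].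
  have [x xp] := quo_surj p; split; first by exists x; apply/FME; rewrite xp.
  by move=> y z /FME/p_uniq py /FME/p_uniq pz; apply/orbit_quoP; rewrite -py.
exists (quo a x); split; first exact/FME.
move=> p; have [y <-] := quo_surj p => /FME ym.
by apply/orbit_quoP; exact: EFM_uniq.
Qed.
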